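(* Let $A=(D_A,\nabla_A,\vdash_A)$ be an algebraic information system. Then the set $|\mathrm{Sub}(A)|$ of all generalized non-trivial closures $f$ from $A$ to $A_\top$ is an algebraic subdomain of the algebraic Scott domain $|[A\to A_\top]|$ of all approximable mappings from $A$ to $A_\top$ (ordered by inclusion); that is, there is an algebraic information system $S$ with $|S|=|\mathrm{Sub}(A)|\subseteq |[A\to A_\top]|$. Hence $|\mathrm{Sub}(A)|$, ordered by inclusion, is itself an algebraic Scott domain.
   Context: For a set $D$, $\mathcal P_{\rm fin}(D)$ denotes the set of its finite subsets. An algebraic information system is a triple $A=(D_A,\nabla_A,\vdash_A)$ with $D_A$ a set, $\nabla_A\in D_A$, and $\vdash_A\subseteq \mathcal P_{\rm fin}(D_A)\times\mathcal P_{\rm fin}(D_A)$ such that for all finite sets: (1) $\emptyset\not\vdash_A\{\nabla_A\}$; (2) $v\subseteq u$ implies $u\vdash_A v$; (3) $u\vdash_A v_1,\dots,u\vdash_A v_n$ and $v_1\cup\dots\cup v_n\vdash_A w$ imply $u\vdash_A w$; (4) $\{\nabla_A\}\vdash_A u$. The domain $|A|$ is the set of all $x\subseteq D_A$ with $\nabla_A\notin x$ such that $u\subseteq x$ finite and $u\vdash_A v$ imply $v\subseteq x$; it is ordered by inclusion. For algebraic information systems $A,B$, the domain $|B|$ is an algebraic subdomain of $|A|$ if $|B|\subseteq|A|$. An approximable mapping from $A$ to $B$ is a relation $f\subseteq\mathcal P_{\rm fin}(D_A)\times\mathcal P_{\rm fin}(D_B)$ such that: (1) $\emptyset f\emptyset$;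 (2) $u\not\vdash_A\{\nabla_A\}$ implies $\neg(u f\{\nabla_B\})$; (3) $\{\nabla_A\} f\{\nabla_B\}$; (4) $u f v_1,\dots,u f v_n$ imply $u f(v_1\cup\dots\cup v_n)$; (5) $u'\vdash_A u$, $u f v$, $v\vdash_B v'$ imply $u' f v'$. The set of all approximable mappings from $A$ to $B$, ordered by inclusion, is the domain $|[A\to B]|$ of an algebraic information system $[A\to B]$ with token set $\mathcal P_{\rm fin}(D_A)\times\mathcal P_{\rm fin}(D_B)$. $A_\top$ is the algebraic information system with tokens $D_A\cup\{\nabla_{A_\top}\}$, where $\nabla_{A_\top}\notin D_A$ is its false statement, and $u\vdash_{A_\top}v$ iff $u\vdash_A v$ or $\nabla_{A_\top}\in u$. Then $|A_\top|=|A|\cup\{\top\}$ with $\top=D_A$. A generalized non-trivial closure is an approximable mapping $f$ from $A$ to $A_\top$ such that for all $u,v,w\in\mathcal P_{\rm fin}(D_A)$: (i) $u\vdash_A v$ implies $u f v$; (ii) $u f v$ and $v f w$ imply $u f w$; (iii) $\neg(\emptyset f\{\nabla_A\})$, i.e. the associated function sends the least element of $|A|$ to an element different from $\top$. An algebraic Scott domain is a poset with least element in which every directed subset has a least upper bound, every element is the directed supremum of the compact elements below it, and every subset with an upper bound has a least upper bound. *)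

(* Defs.v *)
From HB Require Import structures.
From mathcomp Require Import all_boot all_order finmap.
From mathcomp Require Import boolp classical_sets.

Set Implicit Arguments.
Unset Strict Implicit.
Unset Printing Implicit Defensive.
Import Order.TTheory.
Local Open Scope classical_set_scope.

(* In the two n-ary clauses below ([entails_trans], [approx_join]) the finite
   family v_1, ..., v_n is a sequence, possibly empty. *)
Record ais (D : choiceType) : Type := Ais {
  nabla : D ;
  entails : {fset D} -> {fset D} -> Prop ;
  entails_consistent : ~ entails fset0 [fset nabla]%fset ;
  entails_sub : forall u v : {fset D}, (v `<=` u)%fset -> entails u v ;
  entails_trans : forall (u w : {fset D}) (s : seq {fset D}),
    (forall v, v \in s -> entails u v) ->
    entails (\bigcup_(v <- s) v)%fset w -> entails u w ;
  entails_nabla : forall u : {fset D}, entails [fset nabla]%fset u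
}.

Definition dom (D : choiceType) (A : ais D) : set (set D) :=
  [set x | ~ x (nabla A) /\
    forall u v : {fset D}, [set` u] `<=` x -> entails A u v -> [set` v] `<=` x].

Definition algebraic_subdomain (D : choiceType) (B A : ais D) : Prop :=
  dom B `<=` dom A.

Record approximable (D E : choiceType) (A : ais D) (B : ais E)
    (f : set ({fset D} * {fset E})) : Prop := Approximable {
  approx_empty : f (fset0, fset0) ;
  approx_consistent : forall u : {fset D},
    ~ entails A u [fset nabla A]%fset -> ~ f (u, [fset nabla B]%fset) ;
  approx_nabla : f ([fset nabla A]%fset, [fset nabla B]%fset) ;
  approx_join : forall (u : {fset D}) (s : seq {fset E}),
    (forall v, v \in s -> f (u, v)) -> f (u, (\bigcup_(v <- s) v)%fset) ;
  approx_entails : forall (u' u : {fset D}) (v v' : {fset E}),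
    entails A u' u -> f (u, v) -> entails B v v' -> f (u', v')
}.

Section Entails.
Variables (D : choiceType) (A : ais D).
Implicit Types u v w : {fset D}.

Lemma entails_refl u : entails A u u.
Proof. exact/entails_sub/fsubset_refl. Qed.

Lemma entails_comp u v w : entails A u v -> entails A v w -> entails A u w.
Proof.
move=> uv vw; apply: (entails_trans (s := [:: v])) => [v'|].
  by rewrite inE => /eqP ->.
by rewrite big_seq1.
Qed.

Lemma entails_bigcup u (s : seq {fset D}) :
  (forall v, v \in s -> entails A u v) -> entails A u (\bigcup_(v <- s) v)%fset.
Proof. by move=> us; exact: (entails_trans us (entails_refl _)). Qed.

End Entails.

Section FunctionSpace.
Variables (D E : choiceType) (A : ais D) (B : ais E).
Let T : choiceType := ({fset D} * {fset E})%type.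

Definition fun_nabla : T := (fset0, [fset nabla B]%fset).

(* Entailment in an information system is determined by the domain: u entails v
   iff every element of the domain that includes u includes v.  This is the
   entailment for which the domain is the set of approximable mappings; see
   [dom_fun_ais]. *)
Definition fun_entails (X Y : {fset T}) : Prop :=
  forall f, approximable A B f -> [set` X] `<=` f -> [set` Y] `<=` f.

Lemma fun_nabla_notin f : approximable A B f -> ~ f fun_nabla.
Proof. by move=> af; apply: approx_consistent af _ _; exact: entails_consistent. Qed.

Lemma approximable_least : approximable A B
  [set p | entails A p.1 [fset nabla A]%fset \/ entails B fset0 p.2].
Proof.
split => /=.
- by right; exact: entails_refl.
- by move=> u nu [//|]; exact: entails_consistent.
- by left; exact: entails_refl.
- move=> u s us; have [un|un] := pselect (entails A u [fset nabla A]%fset).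
    by left.
  by right; apply: entails_bigcup => v /us [].
- move=> u' u v v' u'u [un|vn] vv'.
    by left; exact: entails_comp un.
  by right; exact: entails_comp vv'.
Qed.

Lemma fun_entails_consistent : ~ fun_entails fset0 [fset fun_nabla]%fset.
Proof.
move=> /(_ _ approximable_least) h.
apply: (fun_nabla_notin approximable_least); apply: h => [p|] /=.
  by rewrite inE.
by rewrite inE.
Qed.

Lemma fun_entails_sub (X Y : {fset T}) : (Y `<=` X)%fset -> fun_entails X Y.
Proof. by move=> /fsubsetP YX f _ Xf p /= /YX; exact: Xf. Qed.

Lemma fun_entails_trans (X Z : {fset T}) (s : seq {fset T}) :
  (forall Y, Y \in s -> fun_entails X Y) ->
  fun_entails (\bigcup_(Y <- s) Y)%fset Z -> fun_entails X Z.
Proof.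
move=> Xs sZ f af Xf; apply: sZ => // p /= /bigfcupP[Y /andP[Ys _] pY].
exact: (Xs _ Ys f).
Qed.

Lemma fun_entails_nabla (X : {fset T}) : fun_entails [fset fun_nabla]%fset X.
Proof.
by move=> f af h; case: (fun_nabla_notin af); apply: h; rewrite /= inE.
Qed.

Definition fun_ais : ais T :=
  Ais fun_entails_consistent fun_entails_sub fun_entails_trans fun_entails_nabla.

Lemma dom_fun_ais : dom fun_ais = [set f | approximable A B f].
Proof.
apply/seteqP; split => [x /= [xn xcl]|f /= af]; last first.
  split; first exact: fun_nabla_notin.
  by move=> X Y Xf XY; exact: XY.
have cl (X : {fset T}) p : [set` X] `<=` x ->
    (forall f, approximable A B f -> [set` X] `<=` f -> f p) -> x p.
  move=> Xx Xp; apply: (xcl X [fset p]%fset) => //=; last by rewrite inE.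
  by move=> f af Xf q /=; rewrite inE => /eqP ->; exact: Xp.
split.
- by apply: (cl fset0) => [p|f []//]; rewrite /= inE.
- move=> u un xu; apply: xn; apply: (cl [fset (u, [fset nabla B])]%fset).
    by move=> p /=; rewrite inE => /eqP ->.
  move=> f af h; exfalso; apply: (approx_consistent af un).
  by apply: h; rewrite /= inE.
- by apply: (cl fset0) => [p|f []//]; rewrite /= inE.
- move=> u s us; apply: (cl [fset (u, v) | v in s]%fset).
    by move=> p /= /imfsetP[v /= vs ->]; exact: us.
  move=> f af h; apply: (approx_join af) => // v vs; apply: h => /=.
  by apply/imfsetP; exists v.
- move=> u' u v v' u'u xuv vv'; apply: (cl [fset (u, v)]%fset).
    by move=> p /=; rewrite inE => /eqP ->.
  move=> f af h; apply: (approx_entails af u'u _ vv').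
  by apply: h; rewrite /= inE.
Qed.

End FunctionSpace.

Section Top.
Variables (D : choiceType) (A : ais D).

(* D_A together with a fresh token is [option D], the fresh token being [None]. *)
Definition fsome (u : {fset D}) : {fset option D} := [fset Some x | x in u]%fset.

Definition top_entails (u v : {fset option D}) : Prop :=
  None \in u \/
  exists u0 v0, [/\ u = fsome u0, v = fsome v0 & entails A u0 v0].

Let fpre (u : {fset option D}) : {fset D} := [fset x in pmap id u]%fset.

Let in_fpre u x : (x \in fpre u) = (Some x \in u).
Proof.
rewrite !inE /= mem_pmap; apply/mapP/idP => /= [[y yu ->]//|xu].
by exists (Some x).
Qed.

Let in_fsome u (x : D) : (Some x \in fsome u) = (x \in u).
Proof. by rewrite mem_imfset //= => y z []. Qed.

Let None_fsome u : None \in fsome u = false.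
Proof. by apply/negP => /imfsetP[]. Qed.

Let fsomeK : cancel fsome fpre.
Proof. by move=> u; apply/fsetP => x; rewrite in_fpre in_fsome. Qed.

Let fpreK u : None \notin u -> fsome (fpre u) = u.
Proof.
move=> /negPf nu; apply/fsetP => -[x|].
  by rewrite in_fsome in_fpre.
by rewrite None_fsome nu.
Qed.

Lemma top_entails_consistent : ~ top_entails fset0 [fset None]%fset.
Proof.
case=> [|[u0 [v0 [_ /fsetP/(_ None)]]]]; first by rewrite inE.
by rewrite None_fsome inE.
Qed.

Lemma top_entails_sub (u v : {fset option D}) :
  (v `<=` u)%fset -> top_entails u v.
Proof.
move=> /fsubsetP vu; have [nu|nu] := boolP (None \in u); first by left.
have nv : None \notin v by apply: contra nu; exact: vu.
right; exists (fpre u), (fpre v); rewrite !fpreK//; split => //.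
by apply/entails_sub/fsubsetP => x; rewrite !in_fpre; exact: vu.
Qed.

Lemma top_entails_trans (u w : {fset option D}) (s : seq {fset option D}) :
  (forall v, v \in s -> top_entails u v) ->
  top_entails (\bigcup_(v <- s) v)%fset w -> top_entails u w.
Proof.
move=> us sw; have [nu|nu] := boolP (None \in u); first by left.
have us' v : v \in s -> None \notin v /\ entails A (fpre u) (fpre v).
  move=> /us[nu'|[u0 [v0 [-> -> u0v0]]]]; first by rewrite nu' in nu.
  by rewrite !fsomeK None_fsome.
case: sw => [/bigfcupP[v /andP[/us'[nv _] _]]|[s0 [w0 [es ew sw]]]].
  by rewrite (negPf nv).
right; exists (fpre u), w0; rewrite fpreK//; split => //.
apply: (entails_trans (s := map fpre s)) => [_ /mapP[v vs ->]|].
  by case: (us' v vs).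
rewrite big_map; suff -> : (\bigcup_(v <- s) fpre v)%fset = s0 by [].
rewrite -(fsomeK s0) -es; apply/fsetP => x; rewrite in_fpre.
apply/bigfcupP/bigfcupP => -[v vs xv]; exists v => //.
  by rewrite -in_fpre.
by rewrite in_fpre.
Qed.

Lemma top_entails_nabla (u : {fset option D}) : top_entails [fset None]%fset u.
Proof. by left; rewrite inE. Qed.

Definition top_ais : ais (option D : choiceType) :=
  Ais top_entails_consistent top_entails_sub top_entails_trans top_entails_nabla.

(* Finite subsets of D_A are regarded as sets of tokens of A_top along [fsome]. *)
Definition gnt_closures : set (set ({fset D} * {fset option D})) :=
  [set f | [/\ approximable A top_ais f,
    forall u v : {fset D}, entails A u v -> f (u, fsome v),
    forall u v w : {fset D},
      f (u, fsome v) -> f (v, fsome w) -> f (u, fsome w)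
    & ~ f (fset0, fsome [fset nabla A]%fset)]].

Lemma dom_top_ais : dom top_ais = [set Some @` x | x in dom A] `|` [set range Some].
Proof.
have fsS u (x : set D) : [set` fsome u] `<=` Some @` x <-> [set` u] `<=` x.
  split => [h y yu|h _ /= /imfsetP[y /= yu ->]].
    by case: (h (Some y)) => /=; [rewrite in_fsome|move=> z xz [<-]].
  by exists y => //; exact: h.
apply/seteqP; split => [x [xn xcl]|x [[y [yn ycl] <-]|->]].
- have xE : x = Some @` (Some @^-1` x).
    apply/seteqP; split => [[a|] xa|_ [a xa <-]//]; last by case: xn.
    by exists a.
  have [xA|xA] := pselect (x (Some (nabla A))).
    right; rewrite /= xE; congr (_ @` _); apply/seteqP; split => // a _ /=.
    apply: (xcl (fsome [fset nabla A]%fset) (fsome [fset a]%fset)).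
    + by move=> _ /= /imfsetP[b /= + ->]; rewrite inE => /eqP ->.
    + right; exists [fset nabla A]%fset, [fset a]%fset; split => //.
      exact: entails_nabla.
    + by rewrite /= in_fsome inE.
  left; exists (Some @^-1` x) => //; split => // u v ux uv.
  rewrite -fsS -xE; apply: (xcl (fsome u)); last by right; exists u, v.
  by rewrite xE fsS.
- split => [[]//|u v uy [nu|[u0 [v0 [eu ev uv]]]]].
    by have [] := uy None nu.
  by rewrite ev fsS; apply: ycl uv; rewrite -fsS -eu.
- split => [[]//|u v uy [nu|[u0 [v0 [_ ev _]]]]].
    by have [] := uy None nu.
  by rewrite ev fsS.
Qed.

End Top.

(* A family of subsets as a poset, for the inclusion order inherited from [set T]. *)
Definition family_poset (T : Type) (F : set (set T)) : Type := set_type F.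

HB.instance Definition _ (T : Type) (F : set (set T)) :=
  SubChoice.copy (family_poset F) (set_type F).
HB.instance Definition _ (T : Type) (F : set (set T)) :=
  [SubChoice_isSubPOrder of family_poset F by <: with set_display].

Lemma family_poset_leE (T : Type) (F : set (set T)) (x y : family_poset F) :
  (x <= y)%O <-> val x `<=` val y.
Proof. by rewrite -subsetEset -Order.le_val. Qed.

Section ScottDomain.
Context {d : Order.disp_t} {P : porderType d}.
Implicit Types (S : set P) (x k : P).

Definition directed S : Prop :=
  S !=set0 /\
  forall x y, S x -> S y -> exists z, [/\ S z, (x <= z)%O & (y <= z)%O].

Definition compact_elt k : Prop :=
  forall S x, directed S -> isLub S x -> (k <= x)%O ->
    exists2 y, S y & (k <= y)%O.

End ScottDomain.

Definition algebraic_scott_domain {d : Order.disp_t} (P : porderType d) : Prop :=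
  [/\ exists b : P, forall x, (b <= x)%O,
      forall S : set P, directed S -> exists x, isLub S x,
      forall x : P, let K := [set k | compact_elt k /\ (k <= x)%O] in
        directed K /\ isLub K x
    & forall S : set P, has_ubound S -> exists x, isLub S x].

(* Main.v *)
(** The domain of any algebraic information system is an algebraic Scott domain:
    its bounded suprema are intersections of upper bounds, its directed suprema
    are unions, and its compact elements are generated by finite consistent sets
    of tokens.  It therefore suffices to present the generalized non-trivial
    closures as such a domain.  Each of their defining conditions either has
    finitely many premises and one conclusion or excludes a single token, so a
    relation is such a closure as soon as it contains every pair that finitely
    many of its pairs force in all such closures. *)

Require Import Defs.
From mathcomp Require Import all_boot all_order finmap.
From mathcomp Require Import boolp classical_sets.
Local Open Scope classical_set_scope.

(** * Compact elements of a poset *)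

Section CompactJoin.
Set Implicit Arguments.
Unset Strict Implicit.
Import Order.TTheory.
Context {d : Order.disp_t} {P : porderType d}.
Implicit Types k x : P.

Lemma compact_elt_bottom x : (forall y, (x <= y)%O) -> compact_elt x.
Proof. by move=> xmin S y [[s Ss] _] _ _; exists s. Qed.

(** Members of a directed set above [k1] and above [k2] have a common upper bound in that set. *)
Lemma compact_elt_lub2 k1 k2 x :
  compact_elt k1 -> compact_elt k2 -> isLub [set k1; k2] x -> compact_elt x.
Proof.
move=> c1 c2 [ub lub] S y dS yS xy.
have [|s1 Ss1 ks1] := c1 S y dS yS.
  by apply: le_trans xy; apply: ub; left.
have [|s2 Ss2 ks2] := c2 S y dS yS.
  by apply: le_trans xy; apply: ub; right.
have [z [Sz s1z s2z]] := dS.2 _ _ Ss1 Ss2.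
exists z => //; apply: lub => _ [->|->].
- exact: le_trans ks1 s1z.
- exact: le_trans ks2 s2z.
Qed.

End CompactJoin.

(** * Domains of information systems as algebraic Scott domains *)

Section DomainIsScott.
Set Implicit Arguments.
Unset Strict Implicit.
Import Order.TTheory.
Variables (D : choiceType) (A : ais D).
Local Notation P := (family_poset (dom A)).
Implicit Types (u v : {fset D}) (S : set P).

Let elt (x : set D) (xA : dom A x) : P := exist _ x (mem_set xA).

(** For consistent [u] this is the least element of the domain that includes [u]; otherwise it is
    all of [D]. *)
Definition token_closure u : set D := [set a | entails A u [fset a]%fset].

Lemma sub_token_closure u : [set` u] `<=` token_closure u.
Proof. by move=> a au; apply: entails_sub; rewrite fsub1set. Qed.

Lemma entails_token_closure u v : [set` v] `<=` token_closure u -> entails A u v.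
Proof.
move=> uv; apply: (entails_trans (s := [seq [fset a]%fset | a <- v])).
  by move=> _ /mapP[a av ->]; exact: uv.
apply: entails_sub; apply/fsubsetP => a av.
apply/bigfcupP; exists [fset a]%fset; last by rewrite inE.
by rewrite andbT; apply/mapP; exists a.
Qed.

Lemma dom_token_closure u :
  ~ entails A u [fset nabla A]%fset -> dom A (token_closure u).
Proof.
move=> cu; split=> // v w /entails_token_closure uv vw a aw.
apply: entails_comp uv _; apply: entails_comp vw _.
by apply: entails_sub; rewrite fsub1set.
Qed.

Lemma token_closure_sub u (x : set D) :
  dom A x -> [set` u] `<=` x -> token_closure u `<=` x.
Proof.
move=> [_ xcl] ux a ua; apply: (xcl u [fset a]%fset) => //=.
by rewrite inE.
Qed.

Lemma dom_consistent u (x : set D) :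
  dom A x -> [set` u] `<=` x -> ~ entails A u [fset nabla A]%fset.
Proof.
move=> xA ux un; apply: xA.1; exact: token_closure_sub un.
Qed.

(** Induction on [u]: directedness merges a member covering the earlier tokens with one containing
    the new token. *)
Lemma fset_sub_directed S u :
  directed S -> [set` u] `<=` \bigcup_(x in S) val x ->
  exists2 x, S x & [set` u] `<=` val x.
Proof.
move=> [[x0 Sx0] dS]; elim/fset1U_rect: u => [_|a u _ IH auS].
  by exists x0.
have [|x Sx ux] := IH; first by move=> b bu; apply: auS; rewrite /= !inE bu orbT.
have [|y Sy ya] := auS a; first by rewrite /= !inE eqxx.
have [z [Sz /family_poset_leE xz /family_poset_leE yz]] := dS _ _ Sx Sy.
exists z => // b /=; rewrite !inE => /orP[/eqP ->|/ux /xz //].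
exact: yz.
Qed.

Lemma dom_directed_bigcup S : directed S -> dom A (\bigcup_(x in S) val x).
Proof.
move=> dS; split=> [[x _]|u v uS uv]; first exact: (set_valP x).1.
have [x Sx ux] := fset_sub_directed dS uS.
by move=> a av; exists x => //; apply: (set_valP x).2 ux uv _ av.
Qed.

Lemma isLub_bigcup S (dS : directed S) : isLub S (elt (dom_directed_bigcup dS)).
Proof.
split=> [x Sx|y yS]; apply/family_poset_leE; first by move=> a xa; exists x.
by move=> a [x Sx xa]; move/yS/family_poset_leE: Sx; exact.
Qed.

Lemma compact_token_closure u (cu : ~ entails A u [fset nabla A]%fset) :
  compact_elt (elt (dom_token_closure cu)).
Proof.
move=> S x dS [_ lub] /family_poset_leE ux.
(* The union is an upper bound of [S], so its tokens include those of the least one, [x]. *)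
have /family_poset_leE xS := lub _ (isLub_bigcup dS).1.
have [|y Sy uy] := @fset_sub_directed S u dS.
  by move=> a /sub_token_closure /ux /xS.
exists y => //; apply/family_poset_leE.
exact: token_closure_sub (set_valP y) uy.
Qed.

Lemma dom_bounded_lub S : has_ubound S -> exists x, isLub S x.
Proof.
move=> [y yS].
have iA : dom A (\bigcap_(z in ubound S) val z).
  (* The given bound [y] keeps [nabla A] out of the intersection. *)
  split=> [/(_ _ yS)|u v uS uv a av z zS]; first exact: (set_valP y).1.
  by apply: (set_valP z).2 uv _ av => b /uS; exact.
exists (elt iA); split=> [x Sx|z zS]; apply/family_poset_leE => a; last exact.
by move=> xa z zS; move/zS/family_poset_leE: Sx; exact.
Qed.

Let bot : P := elt (dom_token_closure (@entails_consistent D A)).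

Let bot_le (x : P) : (bot <= x)%O.
Proof.
apply/family_poset_leE; apply: token_closure_sub (set_valP x) _ => a /=.
by rewrite inE.
Qed.

Lemma dom_algebraic_scott_domain : algebraic_scott_domain P.
Proof.
split; first by exists bot.
- by move=> S dS; exists (elt (dom_directed_bigcup dS)); exact: isLub_bigcup.
- move=> x K; split.
    split; first by exists bot; split; [exact: compact_elt_bottom|].
    move=> k1 k2 [c1 k1x] [c2 k2x].
    (* Being bounded by [x], the pair has a least upper bound, which is again compact and below
       [x]. *)
    have ubx : ubound [set k1; k2] x by move=> _ [->|->].
    have [k kl] := @dom_bounded_lub [set k1; k2] (ex_intro _ x ubx).
    exists k; split; [|by apply: kl.1; left|by apply: kl.1; right].
    by split; [exact: compact_elt_lub2 kl|exact: kl.2].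
  split=> [k []//|y yK]; apply/family_poset_leE => a xa.
  (* Each token [a] of [x] already lies in a compact element below [x], the closure of its
     singleton. *)
  have ax : [set` [fset a]%fset] `<=` val x by move=> b /=; rewrite inE => /eqP ->.
  have ca := dom_consistent (set_valP x) ax.
  have /yK/family_poset_leE : K (elt (dom_token_closure ca)).
    split; first exact: compact_token_closure.
    by apply/family_poset_leE; exact: token_closure_sub (set_valP x) ax.
  by apply; apply: sub_token_closure; rewrite /= inE.
- exact: dom_bounded_lub.
Qed.

End DomainIsScott.

(** * An information system for the generalized non-trivial closures *)

Section Sub.
Set Implicit Arguments.
Unset Strict Implicit.
Variables (D : choiceType) (A : ais D).
Let T : choiceType := ({fset D} * {fset option D})%type.
Implicit Types (X Y Z : {fset T}) (f : set T).

Lemma fsome_inj : injective (@fsome D).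
Proof.
move=> u v /fsetP uv; apply/fsetP => a.
by have := uv (Some a); rewrite !mem_imfset//= => b c [].
Qed.

Lemma None_notin_fsome (u : {fset D}) : None \notin fsome u.
Proof. by apply/imfsetP => -[]. Qed.

(** An inconsistent set must be related to everything, also to sets containing [None]; hence the
    first disjunct. This closure witnesses that the empty set of pairs is consistent. *)
Definition least_closure : set T :=
  [set p | entails A p.1 [fset nabla A]%fset \/
    exists2 v, p.2 = fsome v & entails A p.1 v].

Lemma least_closure_fsome u v :
  least_closure (u, fsome v) <-> entails A u v.
Proof.
split=> [[un|[w /fsome_inj ->]//]|uv]; last by right; exists v.
exact: entails_comp un (entails_nabla _ _).
Qed.

Lemma gnt_least_closure : gnt_closures A least_closure.
Proof.
split.
- split.
  + right; exists fset0; last exact: entails_refl.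
    by apply/fsetP => x; apply/esym/imfsetP; rewrite inE => -[].
  + move=> u un [//|[v /= ev _]].
    by have := None_notin_fsome v; rewrite -ev inE.
  + by left; exact: entails_refl.
  + move=> u s us; have [un|un] := pselect (entails A u [fset nabla A]%fset).
      by left.
    (* For consistent [u] no member of [s] contains [None], so stripping [Some] from the union loses
       nothing. *)
    right; exists [fset x in pmap id (\bigcup_(v <- s) v)%fset]%fset => /=.
      apply/fsetP => -[a|].
        rewrite mem_imfset; last by move=> b c [].
        rewrite !inE /= mem_pmap.
        by apply/idP/mapP => [as_|[_ /[swap] <-]//]; exists (Some a).
      rewrite (negPf (None_notin_fsome _)).
      apply/negP => /bigfcupP[v /andP[/us[//|[w /= -> _]] _]].
      by rewrite (negPf (None_notin_fsome _)).
    apply: entails_token_closure => a /=; rewrite !inE /= mem_pmap.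
    case/mapP => _ /[swap] <- /bigfcupP[v /andP[/us[//|[w /= -> uw]] _]].
    rewrite mem_imfset; last by move=> b c [].
    move=> aw; apply: entails_comp uw _.
    by apply: entails_sub; rewrite fsub1set.
  + move=> u' u v v' u'u [un _|[w /= -> uw]].
      by left; exact: entails_comp un.
    case=> [|[u0 [v0 [/fsome_inj <- -> wv0]]]].
      by rewrite (negPf (None_notin_fsome _)).
    by right; exists v0 => //; apply: entails_comp u'u _; exact: entails_comp wv0.
- by move=> u v /least_closure_fsome.
- move=> u v w /least_closure_fsome uv /least_closure_fsome vw.
  by apply/least_closure_fsome; exact: entails_comp vw.
- by move/least_closure_fsome; exact: entails_consistent.
Qed.

Definition sub_entails X Y : Prop :=
  forall f, gnt_closures A f -> [set` X] `<=` f -> [set` Y] `<=` f.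

Let tok : T := fun_nabla D (top_ais A).

Let tok_notin f : gnt_closures A f -> ~ f tok.
Proof. by case=> /fun_nabla_notin. Qed.

Lemma sub_entails_consistent : ~ sub_entails fset0 [fset tok]%fset.
Proof.
move=> /(_ _ gnt_least_closure) h; apply: (tok_notin gnt_least_closure).
by apply: h => [p|] /=; rewrite inE.
Qed.

Lemma sub_entails_sub X Y : (Y `<=` X)%fset -> sub_entails X Y.
Proof. by move=> /fsubsetP YX f _ Xf p /= /YX; exact: Xf. Qed.

Lemma sub_entails_trans X Z (s : seq {fset T}) :
  (forall Y, Y \in s -> sub_entails X Y) ->
  sub_entails (\bigcup_(Y <- s) Y)%fset Z -> sub_entails X Z.
Proof.
move=> Xs sZ f gf Xf; apply: sZ => // p /= /bigfcupP[Y /andP[Ys _] pY].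
exact: (Xs _ Ys f).
Qed.

(** Vacuous, since no closure contains [tok]. *)
Lemma sub_entails_nabla X : sub_entails [fset tok]%fset X.
Proof.
by move=> f gf h; case: (tok_notin gf); apply: h; rewrite /= inE.
Qed.

Definition sub_ais : ais T :=
  Ais sub_entails_consistent sub_entails_sub sub_entails_trans sub_entails_nabla.

Lemma dom_sub_ais : dom sub_ais = gnt_closures A.
Proof.
apply/seteqP; split=> [x /= [xn xcl]|f /= gf]; last first.
  by split=> [|X Y Xf XY]; [exact: tok_notin | exact: XY].
have cl (X : {fset T}) p : [set` X] `<=` x ->
    (forall f, gnt_closures A f -> [set` X] `<=` f -> f p) -> x p.
  move=> Xx Xp; apply: (xcl X [fset p]%fset) => //=; last by rewrite inE.
  by move=> f gf Xf q /=; rewrite inE => /eqP ->; exact: Xp.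
split.
(* What a finite set forces in all approximable mappings it forces in all closures, so
   approximability of [x] comes from the function space. *)
- have : dom (fun_ais A (top_ais A)) x.
    split=> // X Y Xx XY; apply: xcl Xx _ => f [af _ _ _]; exact: XY.
  by rewrite dom_fun_ais.
- move=> u v uv; apply: (cl fset0) => [p|f [_ + _ _] _]; first by rewrite /= inE.
  exact.
- move=> u v w xuv xvw; apply: (cl [fset (u, fsome v); (v, fsome w)]%fset).
    by move=> p /=; rewrite !inE => /orP[/eqP ->|/eqP ->].
  move=> f [_ _ ft _] h; apply: (ft u v w); apply: h; rewrite /= !inE eqxx ?orbT//.
(* No closure contains this pair, so its singleton forces even [tok], which [x] omits. *)
- move=> xe; apply: xn; apply: (cl [fset (fset0, fsome [fset nabla A])]%fset).
    by move=> p /=; rewrite inE => /eqP ->.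
  by move=> f [_ _ _ fe] h; case: fe; apply: h; rewrite /= inE.
Qed.

End Sub.

Theorem theorem7p4p1 (D : choiceType) (A : ais D) :
  [/\ (* |Sub(A)| is an algebraic subdomain of |[A -> A_top]| *)
      exists S : ais ({fset D} * {fset option D})%type,
        dom S = gnt_closures A /\
        algebraic_subdomain S (fun_ais A (top_ais A)),
      (* the ambient domain of all approximable mappings *)
      dom (fun_ais A (top_ais A)) = [set f | approximable A (top_ais A) f],
      algebraic_scott_domain (family_poset (dom (fun_ais A (top_ais A))))
    & algebraic_scott_domain (family_poset (gnt_closures A))].
Proof.
split.
- exists (sub_ais A); split; first exact: dom_sub_ais.
  by rewrite /algebraic_subdomain dom_sub_ais dom_fun_ais => f [].
- exact: dom_fun_ais.
- exact: dom_algebraic_scott_domain.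
- by rewrite -dom_sub_ais; exact: dom_algebraic_scott_domain.
Qed.
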